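(* Suppose that the Banach algebra $A$ is uniformly approximately semi-amenable. Then $A$ is amenable.
   Context: For a Banach $A$-bimodule $X$, $X^*$ is a Banach $A$-bimodule via $\langle a\cdot f,x\rangle=\langle f,x\cdot a\rangle$, $\langle f\cdot a,x\rangle=\langle f,a\cdot x\rangle$. A derivation is a linear $D:A\to X^*$ with $D(ab)=a\cdot D(b)+D(a)\cdot b$. $A$ is uniformly approximately semi-amenable if for every Banach $A$-bimodule $X$ and every continuous derivation $D:A\to X^*$ there are nets (equivalently sequences) $(\xi_n),(\eta_n)$ in $X^*$ such that the maps $a\mapsto a\cdot\xi_n-\eta_n\cdot a$ converge to $D$ in operator norm, i.e. uniformly on $\{a:\|a\|\le1\}$. $A$ is amenable if for every Banach $A$-bimodule $X$ every continuous derivation $D:A\to X^*$ is inner, i.e. of the form $D(a)=a\cdot\xi-\xi\cdot a$ for some $\xi\in X^*$. *)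

(* Defs.v *)
From HB Require Import structures.
From mathcomp Require Import all_boot all_order all_algebra.
From mathcomp Require Import complex.
From mathcomp Require Import all_classical all_reals all_analysis.
Set Implicit Arguments. Unset Strict Implicit. Unset Printing Implicit Defensive.
Import Order.TTheory GRing.Theory Num.Theory.
Import numFieldNormedType.Exports.
Local Open Scope ring_scope.

Section Defs.
Context {K : numFieldType}.

Definition is_banach_algebra (A : completeNormedModType K)
  (mul : A -> A -> A) : Prop :=
  [/\ (forall a b c, mul a (mul b c) = mul (mul a b) c),
      (forall a (k : K) x y, mul a (k *: x + y) = k *: mul a x + mul a y),
      (forall a (k : K) x y, mul (k *: x + y) a = k *: mul x a + mul y a)
    & (forall a b, `|mul a b| <= `|a| * `|b|)].

Definition is_banach_bimodule (A : completeNormedModType K)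
  (mul : A -> A -> A) (X : completeNormedModType K)
  (la : A -> X -> X) (ra : X -> A -> X) : Prop :=
  (forall a b x, la a (la b x) = la (mul a b) x) /\
  (forall a b x, ra (ra x a) b = ra x (mul a b)) /\
  (forall a b x, ra (la a x) b = la a (ra x b)) /\
  (forall a (k : K) x y, la a (k *: x + y) = k *: la a x + la a y) /\
  (forall x (k : K) a b, la (k *: a + b) x = k *: la a x + la b x) /\
  (forall a (k : K) x y, ra (k *: x + y) a = k *: ra x a + ra y a) /\
  (forall x (k : K) a b, ra x (k *: a + b) = k *: ra x a + ra x b) /\
  (forall a x, `|la a x| <= `|a| * `|x|) /\
  (forall a x, `|ra x a| <= `|x| * `|a|).

Definition is_dual_elt (X : normedModType K) (f : X -> K) : Prop :=
  (forall (k : K) x y, f (k *: x + y) = k * f x + f y) /\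
  exists C : K, forall x, `|f x| <= C * `|x|.

Definition dual_lact (A X : Type) (ra : X -> A -> X) (a : A) (f : X -> K)
  : X -> K := fun x => f (ra x a).
Definition dual_ract (A X : Type) (la : A -> X -> X) (f : X -> K) (a : A)
  : X -> K := fun x => f (la a x).

(* A continuous derivation D : A -> X^*, with D a represented as a
   functional X -> K. Continuity of the linear map A -> X^* is boundedness
   in operator norm. *)
Definition is_cont_derivation (A : normedModType K) (mul : A -> A -> A)
  (X : normedModType K) (la : A -> X -> X) (ra : X -> A -> X)
  (D : A -> X -> K) : Prop :=
  [/\ (forall a, is_dual_elt (D a)),
      (forall (k : K) a b x, D (k *: a + b) x = k * D a x + D b x),
      (exists C : K, forall a x, `|D a x| <= C * `|a| * `|x|)
    & (forall a b, D (mul a b) = fun x =>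
         dual_lact ra a (D b) x + dual_ract la (D a) b x)].

(* Uniform approximate semi-amenability. The operator norm of
   T : A -> X^* is sup_{||a||<=1, ||x||<=1} |<T a, x>|, so convergence
   in operator norm is written out explicitly. *)
Definition unif_approx_semi_amenable (A : completeNormedModType K)
  (mul : A -> A -> A) : Prop :=
  forall (X : completeNormedModType K) (la : A -> X -> X) (ra : X -> A -> X),
    is_banach_bimodule mul la ra ->
    forall D : A -> X -> K, is_cont_derivation mul la ra D ->
    exists (xi eta : nat -> X -> K),
      (forall n, is_dual_elt (xi n)) /\ (forall n, is_dual_elt (eta n)) /\
      forall eps : K, 0 < eps -> exists N : nat, forall n : nat, (N <= n)%N ->
        forall a x, `|a| <= 1 -> `|x| <= 1 ->
          `|dual_lact ra a (xi n) x - dual_ract la (eta n) a x - D a x|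
            <= eps.

Definition amenable (A : completeNormedModType K) (mul : A -> A -> A)
  : Prop :=
  forall (X : completeNormedModType K) (la : A -> X -> X) (ra : X -> A -> X),
    is_banach_bimodule mul la ra ->
    forall D : A -> X -> K, is_cont_derivation mul la ra D ->
    exists xi : X -> K, is_dual_elt xi /\
      forall a x, D a x = dual_lact ra a xi x - dual_ract la xi a x.

End Defs.

(* Main.v *)
Require Import Defs.
From HB Require Import structures.
From mathcomp Require Import all_boot all_order all_algebra.
From mathcomp Require Import complex ring lra.
From mathcomp Require Import all_classical all_reals all_analysis.
Set Implicit Arguments. Unset Strict Implicit. Unset Printing Implicit Defensive.
Import Order.TTheory GRing.Theory Num.Theory.
Import numFieldNormedType.Exports.
Local Open Scope ring_scope.
Local Open Scope complex_scope.

(* Fix a bimodule X and e > 0. Gluing a sequence of derivations A -> X^* into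
   one derivation on the module l^1(N, X) shows that the approximants xi, eta of
   the derivations D of norm at most 1, up to an error e, can be bounded by a
   constant independent of D. Hence, if the approximants can be taken with
   xi = eta, so that D - ad xi is again a derivation, a geometric series shows
   that D is inner.

   This applies to A^* with the trivial left action, and yields E in A^** with
   a.E = a for all a. For general X, the functional zeta = eta - xi satisfies
   |a.zeta.b| <= 3 e |a| |b|, because D is a derivation. For
   f(x) = E(a |-> zeta(x a)) one gets a.f = a.zeta and |f.b| <= 3 |E| e |b|, so
   that a.(eta - f) - (eta - f).a = a.xi - eta.a + f.a is close to D(a):
   the approximants can be taken with xi = eta after all. *)

Local Notation Re := (@complex.Re _).
Local Notation Im := (@complex.Im _).

(** * Real-valued norms, sequential limits and completeness *)

Section RealNorm.
Context {R : realType}.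

(** Norms over [R[i]] are themselves elements of [R[i]]; taking the real part moves them to the
    ordered field [R], where suprema and linear arithmetic are available. *)
Definition nm {V : normedZmodType R[i]} (x : V) : R := Re `|x|.

Lemma normE (V : normedZmodType R[i]) (x : V) : `|x| = (nm x)%:C.
Proof. by rewrite /nm RRe_real// normr_real. Qed.

Lemma nm_ge0 (V : normedZmodType R[i]) (x : V) : 0 <= nm x.
Proof. by rewrite -ler0c -normE normr_ge0. Qed.

Lemma nm0 (V : normedZmodType R[i]) : nm (0 : V) = 0.
Proof. by rewrite /nm normr0. Qed.

Lemma nm_eq0 (V : normedZmodType R[i]) (x : V) : nm x = 0 -> x = 0.
Proof. by move=> h; apply/normr0_eq0; rewrite normE h. Qed.

Lemma nmN (V : normedZmodType R[i]) (x : V) : nm (- x) = nm x.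
Proof. by rewrite /nm normrN. Qed.

Lemma nm_distC (V : normedZmodType R[i]) (x y : V) : nm (x - y) = nm (y - x).
Proof. by rewrite -nmN opprB. Qed.

Lemma nmD (V : normedZmodType R[i]) (x y : V) : nm (x + y) <= nm x + nm y.
Proof. by rewrite -lecR rmorphD/= -!normE ler_normD. Qed.

Lemma nmB (V : normedZmodType R[i]) (x y : V) : nm (x - y) <= nm x + nm y.
Proof. by rewrite -(nmN y) nmD. Qed.

Lemma nm_triangle (V : normedZmodType R[i]) (z x y : V) :
  nm (x - y) <= nm (x - z) + nm (z - y).
Proof. by rewrite -(subrKA z x (- y)) nmD. Qed.

Lemma nmM (x y : R[i]) : nm (x * y) = nm x * nm y.
Proof. by apply: complexI; rewrite rmorphM/= -!normE normrM. Qed.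

Lemma nmZ (V : normedModType R[i]) (k : R[i]) (x : V) :
  nm (k *: x) = nm k * nm x.
Proof. by apply: complexI; rewrite rmorphM/= -!normE normrZ. Qed.

Lemma nmV (x : R[i]) : nm x^-1 = (nm x)^-1.
Proof. by apply: complexI; rewrite fmorphV/= -!normE normfV. Qed.

Lemma nm_gt0 (V : normedZmodType R[i]) (x : V) : x != 0 -> 0 < nm x.
Proof.
by rewrite lt_neqAle nm_ge0 andbT; apply: contra_neq => /esym/nm_eq0.
Qed.

Lemma nmR (r : R) : 0 <= r -> nm r%:C = r.
Proof. by move=> r0; rewrite /nm ger0_norm// ler0c. Qed.

Lemma nm_sum (V : normedZmodType R[i]) (I : Type) (s : seq I) (F : I -> V) :
  nm (\sum_(i <- s) F i) <= \sum_(i <- s) nm (F i).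
Proof.
elim: s => [|i s ih]; first by rewrite !big_nil nm0.
by rewrite !big_cons (le_trans (nmD _ _))// lerD2l.
Qed.

Lemma nm_le_ReIm (z : R[i]) : nm z <= `|Re z| + `|Im z|.
Proof.
rewrite -lecR -normE [in leLHS](complexE z) (le_trans (ler_normD _ _))//.
rewrite rmorphD/= lerD//; first by rewrite !normc_def/= expr0n/= addr0 sqrtr_sqr.
rewrite normrM !normc_def/= !expr0n/= !(addr0, add0r) expr1n.
by rewrite sqrtr1 sqrtr_sqr mul1r.
Qed.

Lemma Re_le_nm (z : R[i]) : `|Re z| <= nm z.
Proof. by rewrite -lecR -normE normc_ge_Re. Qed.

Lemma Im_le_nm (z : R[i]) : `|Im z| <= nm z.
Proof.
rewrite -lecR -normE normc_def lecR -sqrtr_sqr ler_wsqrtr//.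
by rewrite lerDr sqr_ge0.
Qed.

Definition tends (V : normedZmodType R[i]) (u : nat -> V) (l : V) : Prop :=
  forall e : R, 0 < e -> exists N, forall n, (N <= n)%N -> nm (u n - l) <= e.

Definition cauchy_seq (V : normedZmodType R[i]) (u : nat -> V) : Prop :=
  forall e : R, 0 < e ->
    exists N, forall m n, (N <= m)%N -> (N <= n)%N -> nm (u m - u n) <= e.

Definition seq_complete (V : normedZmodType R[i]) : Prop :=
  forall u : nat -> V, cauchy_seq u -> exists l, tends u l.

Lemma nm_eps0 (V : normedZmodType R[i]) (x : V) :
  (forall e : R, 0 < e -> nm x <= e) -> x = 0.
Proof.
move=> h; apply: nm_eq0; apply/eqP; rewrite eq_le nm_ge0 andbT.
by apply/ler_addgt0Pr => e e0; rewrite add0r; exact: h.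
Qed.

Lemma tends_unique (V : normedZmodType R[i]) (u : nat -> V) l l' :
  tends u l -> tends u l' -> l = l'.
Proof.
move=> ul ul'; apply/subr0_eq/nm_eps0 => e e0.
have e20 : 0 < e / 2 by rewrite divr_gt0.
have [N HN] := ul _ e20; have [N' HN'] := ul' _ e20.
pose n := maxn N N'; have := nm_triangle (u n) l l'.
move: (HN n (leq_maxl _ _)) (HN' n (leq_maxr _ _)).
rewrite (nm_distC l (u n)); lra.
Qed.

Lemma tendsD (V : normedZmodType R[i]) (u v : nat -> V) l l' :
  tends u l -> tends v l' -> tends (fun n => u n + v n) (l + l').
Proof.
move=> ul vl e e0; have e20 : 0 < e / 2 by rewrite divr_gt0.
have [N HN] := ul _ e20; have [N' HN'] := vl _ e20.
exists (maxn N N') => n; rewrite geq_max => /andP[/HN h /HN' h'].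
by rewrite opprD addrACA; have := nmD (u n - l) (v n - l'); lra.
Qed.

Lemma tendsZ (V : normedModType R[i]) (k : R[i]) (u : nat -> V) l :
  tends u l -> tends (fun n => k *: u n) (k *: l).
Proof.
move=> ul e e0; have k0 := nm_ge0 k.
have e20 : 0 < e / (nm k + 1) by rewrite divr_gt0//; lra.
have [N HN] := ul _ e20; exists N => n /HN h.
rewrite -scalerBr nmZ (le_trans (ler_wpM2l k0 h))//.
by rewrite mulrCA ler_piMr ?(ltW e0)// ler_pdivrMr//; lra.
Qed.

Lemma tends_le (V : normedZmodType R[i]) (u : nat -> V) l (B : R) :
  tends u l -> (exists N, forall n, (N <= n)%N -> nm (u n) <= B) -> nm l <= B.
Proof.
move=> ul [N' uB]; apply/ler_addgt0Pr => e e0; have [N HN] := ul _ e0.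
pose n := maxn N N'; have := HN n (leq_maxl _ _); have := uB n (leq_maxr _ _).
by have := nm_triangle (u n) l 0; rewrite !subr0 (nm_distC l (u n)); lra.
Qed.

Lemma tendsP (V : normedModType R[i]) (u : nat -> V) l :
  (u n @[n --> \oo] --> l)%classic <-> tends u l.
Proof.
split=> [/cvgrPdist_le h e e0|h].
  have e0' : 0 < e%:C :> R[i] by rewrite ltcR.
  have [N _ HN] := h _ e0'; exists N => n Nn.
  by rewrite -lecR -normE distrC; exact: HN.
apply/cvgrPdist_le => e e0.
have eE : e = (Re e)%:C by rewrite RRe_real// gtr0_real.
have [|N HN] := h (Re e); first by rewrite -ltcR -eE.
by exists N => // n Nn /=; rewrite distrC normE eE lecR; exact: HN.
Qed.

Lemma real_cauchy_cvg (u : nat -> R) :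
  (forall e : R, 0 < e -> exists N, forall m n, (N <= m)%N -> (N <= n)%N ->
     `|u m - u n| <= e) ->
  exists l, forall e, 0 < e -> exists N, forall n, (N <= n)%N -> `|u n - l| <= e.
Proof.
move=> uc; have /cauchy_cvgP/cvg_ex[l ul] : cauchy (u @ \oo)%classic.
  apply: cauchy_exP => e e0.
  have [|N HN] := uc (e / 2); first by rewrite divr_gt0.
  exists (u N); exists N => // n Nn /=; rewrite /ball/=.
  by have := HN N n (leqnn _) Nn; lra.
exists l => e e0; move/cvgrPdist_le : ul => /(_ _ e0)[N _ HN].
by exists N => n Nn; rewrite distrC; exact: HN.
Qed.

Lemma complex_seq_complete : seq_complete R[i].
Proof.
move=> u uc.
have [|a ha] := @real_cauchy_cvg (fun n => Re (u n)).
  move=> e /uc[N HN]; exists N => m n Nm Nn.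
  by have := HN _ _ Nm Nn; apply/le_trans; rewrite -raddfB Re_le_nm.
have [|b hb] := @real_cauchy_cvg (fun n => Im (u n)).
  move=> e /uc[N HN]; exists N => m n Nm Nn.
  by have := HN _ _ Nm Nn; apply/le_trans; rewrite -raddfB Im_le_nm.
exists (a +i* b) => e e0; have e20 : 0 < e / 2 by rewrite divr_gt0.
have [N HN] := ha _ e20; have [N' HN'] := hb _ e20.
exists (maxn N N') => n; rewrite geq_max => /andP[/HN h /HN' h'].
by have := nm_le_ReIm (u n - (a +i* b)); rewrite !raddfB/=; move: h h' => /=; lra.
Qed.

Lemma complete_seq_complete (V : completeNormedModType R[i]) : seq_complete V.
Proof.
move=> u uc; have /cauchy_cvgP/cvg_ex[l ul] : cauchy (u @ \oo)%classic.
  apply: cauchy_exP => e e0.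
  have eE : e = (Re e)%:C by rewrite RRe_real// gtr0_real.
  have Re0 : 0 < Re e by rewrite -ltcR -eE.
  have [|N HN] := uc (Re e / 2); first by rewrite divr_gt0.
  exists (u N); exists N => // n Nn /=; rewrite -ball_normE/= normE eE ltcR.
  by have := HN N n (leqnn _) Nn; lra.
by exists l; exact/tendsP.
Qed.

(** Choose balls of radius 1/(n+1) belonging to the Cauchy filter. Any two of them meet, so their
    centres form a Cauchy sequence, and its limit is a limit of the filter. *)
Lemma seq_complete_complete (V : normedModType R[i]) : seq_complete V ->
  forall F : set_system V, ProperFilter F -> cauchy F -> cvg F.
Proof.
move=> Vc F FF /cauchyP Fc.
have inv0 n : 0 < (n.+1%:R^-1)%:C :> R[i] by rewrite ltcR invr_gt0.
pose u n := sval (cid (Fc _ (inv0 n))).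
have uF n : F (ball (u n) (n.+1%:R^-1)%:C) by exact: svalP (cid (Fc _ (inv0 n))).
have near_inv e : 0 < e -> exists N, forall n, (N <= n)%N -> n.+1%:R^-1 <= e :> R.
  move=> e0; exists (Num.truncn e^-1) => n Nn.
  rewrite -(invrK e) lef_pV2 ?posrE ?invr_gt0//.
  by rewrite ltW// (lt_le_trans (truncnS_gt _))// ler_nat.
have [m|l ul] := Vc u.
  move=> m0; have [|N HN] := near_inv (m / 2); first by rewrite divr_gt0.
  exists N => i j /HN iN /HN jN.
  have [x []] := @filter_ex _ F _ _ (filterI (uF i) (uF j)).
  rewrite -ball_normE/= !normE !ltcR => xi xj.
  have := nm_triangle x (u i) (u j); rewrite (nm_distC x); move: xi xj iN jN.
  by move: (i.+1%:R^-1) (j.+1%:R^-1) => p q; lra.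
apply/cvg_ex; exists l; apply/cvgrPdist_le => e e0.
have eE : e = (Re e)%:C by rewrite RRe_real// gtr0_real.
have Re0 : 0 < Re e / 2 by rewrite divr_gt0// -ltcR -eE.
have [N HN] := near_inv _ Re0; have [N' HN'] := ul _ Re0.
pose n := maxn N N'.
apply: filterS (uF n) => x; rewrite -ball_normE/= !normE eE lecR ltcR => h.
move: h (HN n (leq_maxl _ _)) (HN' n (leq_maxr _ _)).
have := nm_triangle (u n) l x; rewrite (nm_distC l (u n)).
by move: (n.+1%:R^-1) => p; lra.
Qed.

End RealNorm.

(** * Banach spaces of functions normed by a supremum of finite weighted sums *)

Section FunctionSpace.
Variable R : realType.

(* The space of all functions [y : T -> W] in a linear subspace [fs_sub] for
   which the finite weighted sums [fs_semi i y] are bounded in [i], normed by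
   their supremum. Both l^1 sums and dual spaces are of this form. *)
Record fs_data := FsData {
  fs_dom : Type;
  fs_cod : normedModType R[i];
  fs_idx : Type;
  fs_idx0 : fs_idx;
  fs_supp : fs_idx -> seq fs_dom;
  fs_wt : fs_idx -> R;
  fs_sub : (fs_dom -> fs_cod) -> Prop;
  fs_semi := fun i (y : fs_dom -> fs_cod) =>
    fs_wt i * \sum_(s <- fs_supp i) nm (y s);
  fs_wt_ge0 : forall i, 0 <= fs_wt i;
  fs_sub0 : fs_sub (fun=> 0);
  fs_subP : forall (k : R[i]) x y, fs_sub x -> fs_sub y ->
    fs_sub (fun s => k *: x s + y s);
  fs_sub_closed : forall (u : nat -> fs_dom -> fs_cod) y,
    (forall n, fs_sub (u n)) -> (forall s, tends (fun n => u n s) (y s)) ->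
    fs_sub y;
  fs_eval : forall s, exists i, exists2 C, 0 <= C &
    forall y, fs_sub y -> nm (y s) <= C * fs_semi i y;
  fs_cod_complete : seq_complete fs_cod
}.

Variable d : fs_data.
Local Notation T := (fs_dom d).
Local Notation W := (fs_cod d).
Local Notation p := (@fs_semi d).

Lemma fs_semi_ge0 i y : 0 <= p i y.
Proof.
by rewrite mulr_ge0 ?fs_wt_ge0// sumr_ge0// => s _; exact: nm_ge0.
Qed.

Lemma fs_semiD i x y : p i (fun s => x s + y s) <= p i x + p i y.
Proof.
rewrite /fs_semi -mulrDr ler_wpM2l ?fs_wt_ge0// -big_split/=.
by apply: ler_sum => s _; exact: nmD.
Qed.

Lemma fs_semiZ i (k : R[i]) x : p i (fun s => k *: x s) = nm k * p i x.
Proof.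
rewrite /fs_semi mulrCA; congr (_ * _); rewrite mulr_sumr.
by apply: eq_bigr => s _; rewrite nmZ.
Qed.

Definition fs_pred : {pred T -> W} :=
  fun y => `[< fs_sub y /\ exists C : R, forall i, p i y <= C >].

Definition fs_type := {y : T -> W | y \in fs_pred}.

HB.instance Definition _ := SubChoice.on fs_type.

Lemma fs_predP (y : T -> W) :
  reflect (fs_sub y /\ exists C : R, forall i, p i y <= C) (y \in fs_pred).
Proof. exact: asboolP. Qed.

Lemma fs_submod : submod_closed fs_pred.
Proof.
split.
  apply/fs_predP; split; first exact: fs_sub0.
  exists 0 => i; rewrite /fs_semi big1 ?mulr0// => s _; exact: nm0.
move=> k x y /fs_predP[Sx [Cx xC]] /fs_predP[Sy [Cy yC]].
apply/fs_predP; split; first exact: fs_subP.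
exists (nm k * Cx + Cy) => i.
by rewrite (le_trans (fs_semiD _ _ _))// lerD// fs_semiZ ler_wpM2l// nm_ge0.
Qed.

HB.instance Definition _ := GRing.isSubmodClosed.Build _ _ fs_pred fs_submod.
HB.instance Definition _ := [SubChoice_isSubLmodule of fs_type by <:].

Definition fs_fun (y : fs_type) : T -> W := val y.

Definition fs_rnorm (y : fs_type) : R :=
  sup [set r | exists i, r = p i (fs_fun y)]%classic.

Lemma fs_funP k (x y : fs_type) s :
  fs_fun (k *: x + y) s = k *: fs_fun x s + fs_fun y s.
Proof. by []. Qed.

Lemma fs_fun_inj (x y : fs_type) : fs_fun x =1 fs_fun y -> x = y.
Proof. by move=> h; apply: val_inj; apply/funext. Qed.

Lemma fs_fun_sub (y : fs_type) : fs_sub (fs_fun y).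
Proof. by have /fs_predP[] := valP y. Qed.

Lemma fs_has_sup (y : fs_type) :
  has_sup [set r | exists i, r = p i (fs_fun y)]%classic.
Proof.
split; first by exists (p (fs_idx0 d) (fs_fun y)), (fs_idx0 d).
have /fs_predP[_ [C yC]] := valP y.
by exists C => _ [i ->]; exact: yC.
Qed.

Lemma fs_semi_le i y : p i (fs_fun y) <= fs_rnorm y.
Proof.
by apply: sup_upper_bound; [exact: fs_has_sup|exists i].
Qed.

Lemma fs_rnorm_le (C : R) y : (forall i, p i (fs_fun y) <= C) -> fs_rnorm y <= C.
Proof.
move=> h; apply: ge_sup; first by case: (fs_has_sup y).
by move=> _ [i ->].
Qed.

Lemma fs_rnorm_ge0 y : 0 <= fs_rnorm y.
Proof. exact: le_trans (fs_semi_ge0 _ _) (fs_semi_le (fs_idx0 d) y). Qed.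

Lemma fs_rnormD x y : fs_rnorm (x + y) <= fs_rnorm x + fs_rnorm y.
Proof.
apply: fs_rnorm_le => i; rewrite (le_trans (fs_semiD _ _ _))//.
by rewrite lerD// fs_semi_le.
Qed.

Lemma fs_rnormZ_le (k : R[i]) x : fs_rnorm (k *: x) <= nm k * fs_rnorm x.
Proof.
apply: fs_rnorm_le => i; rewrite [leLHS]fs_semiZ.
by rewrite ler_wpM2l ?nm_ge0// fs_semi_le.
Qed.

Lemma fs_rnormZ (k : R[i]) x : fs_rnorm (k *: x) = nm k * fs_rnorm x.
Proof.
apply/eqP; rewrite eq_le fs_rnormZ_le/=.
have [->|k0] := eqVneq k 0; first by rewrite nm0 mul0r fs_rnorm_ge0.
have nk := nm_gt0 k0.
(* The upper bound for the inverse scalar gives the reverse inequality. *)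
have := fs_rnormZ_le k^-1 (k *: x); rewrite scalerA mulVf// scale1r nmV.
by rewrite mulrC ler_pdivlMr// mulrC.
Qed.

(** Continuity of the point evaluations makes the norm definite and gives Cauchy sequences pointwise
    limits. *)
Lemma fs_eval_le s : exists2 C, 0 <= C &
  forall y : fs_type, nm (fs_fun y s) <= C * fs_rnorm y.
Proof.
have [i [C C0 h]] := fs_eval s; exists C => // y.
by rewrite (le_trans (h _ (fs_fun_sub y)))// ler_wpM2l// fs_semi_le.
Qed.

Definition fs_norm (y : fs_type) : R[i] := (fs_rnorm y)%:C.

Lemma fs_normD x y : fs_norm (x + y) <= fs_norm x + fs_norm y.
Proof. by rewrite /fs_norm -rmorphD lecR fs_rnormD. Qed.

Lemma fs_normZ (k : R[i]) x : fs_norm (k *: x) = `|k| * fs_norm x.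
Proof. by rewrite /fs_norm fs_rnormZ rmorphM/= -normE. Qed.

Lemma fs_norm_eq0 x : fs_norm x = 0 -> x = 0.
Proof.
move=> [x0]; apply: fs_fun_inj => s; apply: nm_eq0.
have [C C0 h] := fs_eval_le s.
by apply/eqP; rewrite eq_le nm_ge0 andbT (le_trans (h x))// x0 mulr0.
Qed.

HB.instance Definition _ :=
  Lmodule_isNormed.Build R[i] fs_type fs_normD fs_normZ fs_norm_eq0.

Lemma fs_nmE (y : fs_type) : nm y = fs_rnorm y.
Proof. by []. Qed.

Section Mk.
Variables (y : T -> W) (C : R).
Hypotheses (ys : fs_sub y) (yC : forall i, p i y <= C).

Lemma fs_mk_subproof : y \in fs_pred.
Proof. by apply/fs_predP; split => //; exists C. Qed.

Definition fs_mk : fs_type := exist _ y fs_mk_subproof.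

Lemma fs_mk_nm : nm fs_mk <= C.
Proof. by rewrite fs_nmE; exact: fs_rnorm_le. Qed.

End Mk.

(** Each seminorm sees only finitely many points, so a bound on it passes to pointwise limits. *)
Lemma tends_semi i (u : nat -> T -> W) (v y : T -> W) (B : R) :
  (forall s, tends (fun n => u n s) (y s)) ->
  (exists N, forall n, (N <= n)%N -> p i (fun s => v s - u n s) <= B) ->
  p i (fun s => v s - y s) <= B.
Proof.
move=> uy [N HN]; apply/ler_addgt0Pr => e e0.
have w0 := fs_wt_ge0 i.
(* The [+ 1] keeps the denominator positive when the weight vanishes. *)
pose e' := e / (fs_wt i + 1).
have e'0 : 0 < e' by rewrite divr_gt0//; lra.
have we : fs_wt i * e' <= e.
  by rewrite mulrCA ler_piMr ?(ltW e0)// ler_pdivrMr//; lra.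
have [N' HN'] : exists N', forall n, (N' <= n)%N ->
    \sum_(s <- fs_supp i) nm (u n s - y s) <= e'.
  elim: (fs_supp i) (e') e'0 {we} => [|s l ih] a a0.
    by exists 0%N => n _; rewrite big_nil ltW.
  have a20 : 0 < a / 2 by rewrite divr_gt0.
  have [N1 H1] := ih _ a20; have [N2 H2] := uy s _ a20.
  exists (maxn N1 N2) => n; rewrite geq_max => /andP[/H1 h1 /H2 h2].
  by rewrite big_cons; lra.
pose n := maxn N N'.
have h1 := HN n (leq_maxl _ _); have h2 := HN' n (leq_maxr _ _).
rewrite (_ : (fun s => v s - y s) =
  (fun s => (v s - u n s) + (u n s - y s))); last first.
  by apply/funext => s; rewrite subrKA.
rewrite (le_trans (fs_semiD _ _ _))// lerD//.
by rewrite (le_trans _ we)// ler_wpM2l.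
Qed.

(** The limit is taken pointwise. The Cauchy estimates are uniform in the index of the seminorm, so
    by [tends_semi] they survive in the limit and give convergence in norm. *)
Lemma fs_seq_complete : seq_complete fs_type.
Proof.
move=> u uc.
have uf s : cauchy_seq (fun n => fs_fun (u n) s).
  have [C C0 hC] := fs_eval_le s => e e0.
  have [|N HN] := uc (e / (C + 1)); first by rewrite divr_gt0//; lra.
  exists N => m n Nm Nn; have := hC (u m - u n).
  rewrite (_ : fs_fun (u m - u n) s = fs_fun (u m) s - fs_fun (u n) s)//.
  move=> /le_trans; apply; rewrite (le_trans (ler_wpM2l C0 (HN _ _ Nm Nn)))//.
  by rewrite mulrCA ler_piMr ?(ltW e0)// ler_pdivrMr//; lra.
pose y s := sval (cid (fs_cod_complete (uf s))).
have uy s : tends (fun n => fs_fun (u n) s) (y s).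
  exact: svalP (cid (fs_cod_complete (uf s))).
have close e : 0 < e -> exists N, forall n, (N <= n)%N ->
    forall i, p i (fun s => fs_fun (u n) s - y s) <= e.
  move=> /uc[N HN]; exists N => n Nn i; apply: tends_semi uy _.
  exists N => m Nm; apply: le_trans (HN _ _ Nn Nm).
  exact: fs_semi_le i (u n - u m).
have py : y \in fs_pred.
  apply/fs_predP; split.
    by apply: (fs_sub_closed _ uy) => n; exact: fs_fun_sub.
  (* The limit is bounded, being [u N] minus the difference [u N - y], whose seminorms are all at
     most 1. *)
  have [N HN] := close 1 ltr01; exists (fs_rnorm (u N) + 1) => i.
  have := HN N (leqnn _) i; have := fs_semi_le i (u N).
  have := fs_semiD i (fs_fun (u N)) (fun s => (- 1) *: (fs_fun (u N) s - y s)).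
  rewrite fs_semiZ nmN (nmR ler01) mul1r.
  rewrite (_ : (fun s => _ + _) = y); first lra.
  by apply/funext => s; rewrite scaleN1r opprB addrC subrK.
exists (exist _ y py) => e /close[N HN]; exists N => n Nn.
by rewrite fs_nmE; apply: fs_rnorm_le => i; exact: HN.
Qed.

HB.instance Definition _ := Uniform_isComplete.Build fs_type
  (seq_complete_complete fs_seq_complete).

End FunctionSpace.

(** * Absolutely convergent series of complex numbers *)

Section Series.
Context {R : realType}.
Implicit Types (v w : nat -> R[i]).

Definition abs_summable v (B : R) : Prop :=
  forall N, \sum_(0 <= k < N) nm (v k) <= B.

(** Once a partial sum of the norms is within [e] of their supremum, all later terms together add at
    most [e], so the partial sums of [v] are Cauchy. *)
Lemma abs_summable_tends v B : abs_summable v B ->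
  exists l, tends (fun N => \sum_(0 <= k < N) v k) l.
Proof.
move=> vB; apply: complex_seq_complete => e e0.
pose s N := \sum_(0 <= k < N) nm (v k).
have hs : has_sup [set s N | N in setT]%classic.
  by split; [exists (s 0%N), 0%N|exists B => _ [N _ <-]; exact: vB].
have [_ [N _ <-] sN] := sup_adherent e0 hs.
have key m n : (N <= m)%N -> (m <= n)%N ->
    nm (\sum_(0 <= k < n) v k - \sum_(0 <= k < m) v k) <= e.
  move=> Nm mn; rewrite (big_cat_nat (n := m) _ mn)//= addrAC subrr add0r.
  rewrite (le_trans (nm_sum _ _))//.
  have sn : s n <= sup [set s N | N in setT]%classic.
    by apply: sup_upper_bound => //; exists n.
  have : s n = s m + \sum_(m <= k < n) nm (v k) by rewrite /s (big_cat_nat (n := m)).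
  have : s m = s N + \sum_(N <= k < m) nm (v k) by rewrite /s (big_cat_nat (n := N)).
  have : 0 <= \sum_(N <= k < m) nm (v k) by apply: sumr_ge0 => k _; exact: nm_ge0.
  by lra.
exists N => m n Nm Nn; have [mn|/ltnW nm'] := leqP m n; last exact: key.
by rewrite nm_distC; exact: key.
Qed.

(* Junk value [0] if the series does not converge. *)
Definition csum v : R[i] :=
  xget 0 [set l | tends (fun N => \sum_(0 <= k < N) v k) l]%classic.

Lemma csumP v B : abs_summable v B ->
  tends (fun N => \sum_(0 <= k < N) v k) (csum v).
Proof. by move=> /abs_summable_tends h; exact: (xgetPex 0 h). Qed.

Lemma csum_unique v l : tends (fun N => \sum_(0 <= k < N) v k) l -> csum v = l.
Proof.
by move=> h; apply: (tends_unique _ h); apply: (xgetPex 0); exists l.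
Qed.

Lemma csum_le v B : abs_summable v B -> nm (csum v) <= B.
Proof.
move=> vB; apply: tends_le (csumP vB) _; exists 0%N => n _.
exact: le_trans (nm_sum _ _) (vB n).
Qed.

Lemma csum_lin (k : R[i]) v w B B' : abs_summable v B -> abs_summable w B' ->
  csum (fun n => k * v n + w n) = k * csum v + csum w.
Proof.
move=> vB wB; apply: csum_unique.
have := tendsD (@tendsZ _ R[i]^o k _ _ (csumP vB)) (csumP wB).
congr tends; apply/funext => N.
by rewrite big_split/=; congr (_ + _); rewrite -mulr_sumr.
Qed.

Lemma csum_single n (x : R[i]) : csum (fun k => if k == n then x else 0) = x.
Proof.
apply: csum_unique => e e0; exists n.+1 => N nN.
rewrite -big_mkcond big_nat1_eq/= nN subrr nm0 ltW//.
Qed.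

End Series.

(** * Bounded linear functionals with explicit bounds *)

Section Functionals.
Context {R : realType}.

(** The real bound [C] is kept explicit because the argument hinges on constants that do not depend
    on the derivation. *)
Definition blin (X : normedModType R[i]) (f : X -> R[i]) (C : R) : Prop :=
  [/\ (forall (k : R[i]) x y, f (k *: x + y) = k * f x + f y), 0 <= C
    & forall x, nm (f x) <= C * nm x].

(** The constants in [is_dual_elt] and [is_cont_derivation] lie in [R[i]]. The inequality forces
    [c * s%:C] to be real and nonnegative, hence equal to its norm, so [nm c] serves as a real
    constant. *)
Lemma norm_bound_real (c : R[i]) (r s : R) :
  r%:C <= c * s%:C -> 0 <= r -> 0 <= s -> r <= nm c * s.
Proof.
move=> h r0 s0; rewrite -lecR rmorphM/= -normE (le_trans h)//.
have /ger0_norm <- : 0 <= c * s%:C by rewrite (le_trans _ h)// ler0c.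
by rewrite normrM (@ger0_norm _ s%:C)// ler0c.
Qed.

Lemma is_dual_eltP (X : normedModType R[i]) (f : X -> R[i]) :
  is_dual_elt f <-> exists C, blin f C.
Proof.
split=> [[fl [C fC]]|[C [fl C0 fC]]].
  exists (nm C); split=> // [|x]; first exact: nm_ge0.
  by apply: norm_bound_real; rewrite ?nm_ge0// -!normE.
split=> //; exists C%:C => x.
by rewrite !normE -rmorphM lecR.
Qed.

Section Theory.
Variables (X : normedModType R[i]) (f : X -> R[i]) (C : R).
Hypothesis fC : blin f C.

Lemma blin0 : f 0 = 0.
Proof.
have [fl _ _] := fC; have := fl 1 0 0; rewrite scaler0 add0r mul1r => h.
by apply: (addrI (f 0)); rewrite addr0 -h.
Qed.

End Theory.

(** Semi-amenability gives estimates on unit balls; scaling nonzero vectors to norm 1 makes them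
    homogeneous. *)
Lemma bilinear_ball_bound (A X : normedModType R[i]) (F : A -> X -> R[i]) (e : R) :
  (forall k a x, F (k *: a) x = k * F a x) ->
  (forall k a x, F a (k *: x) = k * F a x) ->
  (forall a x, nm a <= 1 -> nm x <= 1 -> nm (F a x) <= e) ->
  forall a x, nm (F a x) <= e * nm a * nm x.
Proof.
move=> Fl Fr Fb a x.
have [->|a0] := eqVneq a 0.
  by have := Fl 0 0 x; rewrite scale0r mul0r => ->; rewrite !nm0 mulr0 mul0r.
have [->|x0] := eqVneq x 0.
  by have := Fr 0 a 0; rewrite scale0r mul0r => ->; rewrite !nm0 mulr0.
have na := nm_gt0 a0; have nx := nm_gt0 x0.
have unit (V : normedModType R[i]) (v : V) : v != 0 ->
    nm ((nm v)^-1%:C *: v) <= 1.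
  move=> v0; have nv := nm_gt0 v0.
  by rewrite nmZ nmR ?invr_ge0 ?(ltW nv)// mulVf ?gt_eqF.
have := Fb _ _ (unit _ _ a0) (unit _ _ x0).
rewrite Fl Fr !nmM !nmR ?invr_ge0 ?(ltW na) ?(ltW nx)//.
rewrite mulrA -invfM mulrC ler_pdivrMr ?mulr_gt0//.
by rewrite mulrA.
Qed.

End Functionals.

(** * The l^1 sum of copies of a Banach space *)

Section L1.
Variables (R : realType) (X : completeNormedModType R[i]).

(** The seminorms are the partial sums of the norms, so their supremum is the l^1 norm. *)
Let supp (n : nat) := index_iota 0 n.
Let wt (n : nat) : R := 1.

Lemma l1_eval (s : nat) : exists i, exists2 C : R, 0 <= C &
  forall y : nat -> X, True -> nm (y s) <= C * (wt i * \sum_(s <- supp i) nm (y s)).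
Proof.
exists s.+1, 1 => // y _; rewrite !mul1r /supp big_nat_recr//= lerDr.
by apply: sumr_ge0 => k _; exact: nm_ge0.
Qed.

Definition l1_data : fs_data R :=
  @FsData R nat X nat 0%N supp wt (fun=> True) (fun=> ler01) I
    (fun _ _ _ _ _ => I) (fun _ _ _ _ => I) l1_eval (@complete_seq_complete R X).

Definition l1 : completeNormedModType R[i] := fs_type l1_data.

Definition l1_fun (y : l1) : nat -> X := fs_fun y.

Lemma l1_funP k (x y : l1) n : l1_fun (k *: x + y) n = k *: l1_fun x n + l1_fun y n.
Proof. exact: (@fs_funP R l1_data). Qed.

Lemma l1_fun_inj (x y : l1) : l1_fun x =1 l1_fun y -> x = y.
Proof. exact: (@fs_fun_inj R l1_data). Qed.

Lemma l1_sum_le (y : l1) N : \sum_(0 <= k < N) nm (l1_fun y k) <= nm y.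
Proof. by have := @fs_semi_le R l1_data N y; rewrite /fs_semi mul1r. Qed.

Lemma l1_ex (y : nat -> X) (C : R) :
  (forall N, \sum_(0 <= k < N) nm (y k) <= C) ->
  exists2 z : l1, l1_fun z = y & nm z <= C.
Proof.
move=> yC.
have yC' i : fs_semi (f := l1_data) i y <= C by rewrite /fs_semi mul1r; exact: yC.
by exists (fs_mk (d := l1_data) I yC') => //; exact: fs_mk_nm.
Qed.

Lemma l1_inj_ex (n : nat) (x : X) :
  exists2 z : l1, l1_fun z = (fun k => if k == n then x else 0) & nm z <= nm x.
Proof.
apply: l1_ex => N.
rewrite (eq_bigr (fun k => if k == n then nm x else 0)); last first.
  by move=> k _; case: ifP; rewrite ?nm0.
by rewrite -big_mkcond big_nat1_eq; case: ifP => // _; exact: nm_ge0.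
Qed.

Definition l1_inj n x : l1 := sval (cid2 (l1_inj_ex n x)).

Lemma l1_injE n x k : l1_fun (l1_inj n x) k = if k == n then x else 0.
Proof. by rewrite /l1_inj; case: cid2 => z /= ->. Qed.

Lemma l1_inj_nm n x : nm (l1_inj n x) <= nm x.
Proof. by rewrite /l1_inj; case: cid2. Qed.

Lemma l1_map_ex (g : X -> X) (C : R) : 0 <= C ->
  (forall x, nm (g x) <= C * nm x) -> forall y : l1,
  exists2 z : l1, l1_fun z = (fun k => g (l1_fun y k)) & nm z <= C * nm y.
Proof.
move=> C0 gC y; apply: l1_ex => N.
apply: le_trans (ler_wpM2l C0 (l1_sum_le y N)); rewrite mulr_sumr.
by apply: ler_sum => k _.
Qed.

End L1.

(** * The dual Banach space *)

Section Dual.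
Variables (R : realType) (A : normedModType R[i]).

Let lin (f : A -> R[i]^o) : Prop :=
  forall (k : R[i]) x y, f (k *: x + y) = k *: f x + f y.
(** The seminorm at [a] is |f a| / |a|, so the supremum is the operator norm. At [a = 0] the weight
    is 0, the inverse of 0 being 0; this is harmless since linear functionals vanish there. *)
Let supp (a : A) := [:: a].
Let wt (a : A) : R := (nm a)^-1.

Lemma dual_wt_ge0 a : 0 <= wt a.
Proof. by rewrite invr_ge0 nm_ge0. Qed.

Lemma dual_lin0 : lin (fun=> 0).
Proof. by move=> k x y; rewrite scaler0 addr0. Qed.

Lemma dual_linP (k : R[i]) f g : lin f -> lin g -> lin (fun s => k *: f s + g s).
Proof.
move=> fl gl c x y; rewrite fl gl !scalerDr addrACA; congr (_ + _ + _).
by rewrite !scalerA mulrC.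
Qed.

Lemma dual_lin_closed (u : nat -> A -> R[i]^o) f :
  (forall n, lin (u n)) -> (forall s, tends (fun n => u n s) (f s)) -> lin f.
Proof.
move=> ul uf k x y; apply: tends_unique (uf _) _.
have := tendsD (tendsZ k (uf x)) (uf y).
by congr tends; apply/funext => n; rewrite ul.
Qed.

Lemma dual_eval s : exists i, exists2 C : R, 0 <= C &
  forall f, lin f -> nm (f s) <= C * (wt i * \sum_(t <- supp i) nm (f t)).
Proof.
exists s, (nm s) => [|f fl]; first exact: nm_ge0.
rewrite big_seq1; have [->|s0] := eqVneq s 0; last first.
  by rewrite mulrA divff ?mul1r// gt_eqF// nm_gt0.
have := fl 1 0 0; rewrite !scale1r addr0 => /(congr1 (fun z => z - f 0)).
by rewrite subrr addrK => <-; rewrite !nm0 mul0r.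
Qed.

Definition dual_data : fs_data R :=
  @FsData R A R[i]^o A 0 supp wt lin dual_wt_ge0 dual_lin0 dual_linP
    dual_lin_closed dual_eval complex_seq_complete.

Definition dual : completeNormedModType R[i] := fs_type dual_data.

Definition dual_fun (f : dual) : A -> R[i] := fs_fun f.

Lemma dual_funP k (f g : dual) a :
  dual_fun (k *: f + g) a = k * dual_fun f a + dual_fun g a.
Proof. exact: (@fs_funP R dual_data). Qed.

Lemma dual_fun_inj (f g : dual) : dual_fun f =1 dual_fun g -> f = g.
Proof. exact: (@fs_fun_inj R dual_data). Qed.

Lemma dual_blin (f : dual) : blin (dual_fun f) (nm f).
Proof.
split; [exact: (@fs_fun_sub R dual_data)|exact: nm_ge0|move=> a].
have [->|a0] := eqVneq a 0.
  have := @fs_fun_sub R dual_data f 1 0 0; rewrite !scale1r addr0.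
  move=> /(congr1 (fun z => z - dual_fun f 0)); rewrite subrr addrK => f0.
  by rewrite /dual_fun -f0 !nm0 mulr0.
have := @fs_semi_le R dual_data a f; rewrite /fs_semi big_seq1 /= mulrC.
by rewrite ler_pdivrMr// nm_gt0.
Qed.

Lemma dual_ex (f : A -> R[i]) C : blin f C ->
  exists2 g : dual, dual_fun g = f & nm g <= C.
Proof.
move=> [fl C0 fC].
have fC' i : fs_semi (f := dual_data) i f <= C.
  rewrite /fs_semi big_seq1 /=; have [->|i0] := eqVneq i 0.
    by rewrite /wt nm0 invr0 mul0r.
  by rewrite mulrC ler_pdivrMr ?nm_gt0//; exact: fC.
by exists (fs_mk (d := dual_data) fl fC') => //; exact: fs_mk_nm.
Qed.

End Dual.

(** * Bimodules and derivations with explicit bounds *)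

Section Derivations.
Variables (R : realType) (A : completeNormedModType R[i]) (mul : A -> A -> A).

Section Bimodule.
Variables (X : completeNormedModType R[i]) (la : A -> X -> X) (ra : X -> A -> X).
Hypothesis bX : is_banach_bimodule mul la ra.

Lemma la_nm a x : nm (la a x) <= nm a * nm x.
Proof.
by have [_ [_ [_ [_ [_ [_ [_ [h _]]]]]]]] := bX; rewrite -lecR rmorphM/= -!normE.
Qed.

Lemma ra_nm x a : nm (ra x a) <= nm x * nm a.
Proof.
by have [_ [_ [_ [_ [_ [_ [_ [_ h]]]]]]]] := bX; rewrite -lecR rmorphM/= -!normE.
Qed.

Lemma laP a k x y : la a (k *: x + y) = k *: la a x + la a y.
Proof. by have [_ [_ [_ [h _]]]] := bX. Qed.

Lemma laPl x k a b : la (k *: a + b) x = k *: la a x + la b x.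
Proof. by have [_ [_ [_ [_ [h _]]]]] := bX. Qed.

Lemma raP a k x y : ra (k *: x + y) a = k *: ra x a + ra y a.
Proof. by have [_ [_ [_ [_ [_ [h _]]]]]] := bX. Qed.

Lemma raPr x k a b : ra x (k *: a + b) = k *: ra x a + ra x b.
Proof. by have [_ [_ [_ [_ [_ [_ [h _]]]]]]] := bX. Qed.

Lemma laA a b x : la a (la b x) = la (mul a b) x.
Proof. by have [h _] := bX. Qed.

Lemma raA x a b : ra (ra x a) b = ra x (mul a b).
Proof. by have [_ [h _]] := bX. Qed.

Lemma lraA a x b : ra (la a x) b = la a (ra x b).
Proof. by have [_ [_ [h _]]] := bX. Qed.

End Bimodule.

(** The conditions of [is_cont_derivation], with the dual actions unfolded and a real bound [r] on
    the operator norm. *)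
Definition bder (X : normedModType R[i]) (la : A -> X -> X) (ra : X -> A -> X)
    (D : A -> X -> R[i]) (r : R) : Prop :=
  [/\ (forall a (k : R[i]) x y, D a (k *: x + y) = k * D a x + D a y),
      (forall (k : R[i]) a b x, D (k *: a + b) x = k * D a x + D b x),
      0 <= r, (forall a x, nm (D a x) <= r * nm a * nm x)
    & (forall a b x, D (mul a b) x = D b (ra x a) + D a (la b x))].

Lemma is_cont_derivationP (X : normedModType R[i]) (la : A -> X -> X)
    (ra : X -> A -> X) (D : A -> X -> R[i]) :
  is_cont_derivation mul la ra D <-> exists r, bder la ra D r.
Proof.
split=> [[Dd Dl [C DC] DM]|[r [Dr Dl r0 DC DM]]].
  exists (nm C); split=> //.
  - by move=> a k x y; have [h _] := Dd a.
  - exact: nm_ge0.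
  - move=> a x; rewrite -mulrA; apply: norm_bound_real; rewrite ?mulr_ge0 ?nm_ge0//.
    by rewrite rmorphM/= -!normE mulrA.
  - by move=> a b x; rewrite DM.
split=> //.
- move=> a; apply/is_dual_eltP; exists (r * nm a); split=> //.
  by rewrite mulr_ge0// nm_ge0.
- by exists r%:C => a x; rewrite !normE -!rmorphM lecR.
- by move=> a b; apply/funext => x; rewrite DM.
Qed.

Lemma bderW (X : normedModType R[i]) (la : A -> X -> X) (ra : X -> A -> X) D r s :
  bder la ra D r -> r <= s -> bder la ra D s.
Proof.
move=> [Dr Dl r0 DC DM] rs; split=> //; first exact: le_trans rs.
move=> a x; rewrite (le_trans (DC a x))// -!mulrA ler_wpM2r//.
by rewrite mulr_ge0 ?nm_ge0.
Qed.

Lemma bder_scale (X : normedModType R[i]) (la : A -> X -> X) (ra : X -> A -> X)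
    D r (s : R) :
  0 <= s -> bder la ra D r -> bder la ra (fun a x => s%:C * D a x) (s * r).
Proof.
move=> s0 [Dr Dl r0 DC DM]; split.
- by move=> a k x y; rewrite Dr mulrDr mulrCA.
- by move=> k a b x; rewrite Dl mulrDr mulrCA.
- exact: mulr_ge0.
- by move=> a x; rewrite nmM nmR// -!mulrA ler_wpM2l// mulrA DC.
- by move=> a b x; rewrite DM mulrDr.
Qed.

(** The inner derivation a |-> a.f - f.a; on the dual, the left action comes from [ra] and the right
    one from [la]. *)
Definition ad (X : normedModType R[i]) (la : A -> X -> X) (ra : X -> A -> X)
    (f : X -> R[i]) (a : A) (x : X) : R[i] := f (ra x a) - f (la a x).

(** The product rule survives because the mixed terms f(b x a) cancel, which relies on the same
    functional standing on both sides. *)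
Lemma bder_sub_ad (X : completeNormedModType R[i]) (la : A -> X -> X)
    (ra : X -> A -> X) D r f C s :
  is_banach_bimodule mul la ra -> bder la ra D r -> blin f C -> 0 <= s ->
  (forall a x, nm (D a x - ad la ra f a x) <= s * nm a * nm x) ->
  bder la ra (fun a x => D a x - ad la ra f a x) s.
Proof.
move=> bX [Dr Dl r0 DC DM] [fl _ _] s0 h; split=> // [a k x y|k a b x|a b x].
- rewrite /ad Dr (laP bX) (raP bX) !fl; ring.
- rewrite /ad Dl (laPl bX) (raPr bX) !fl; ring.
- rewrite /ad DM (raA bX) (laA bX) (lraA bX); ring.
Qed.

(** * Gluing a sequence of derivations on the l^1 sum *)

Section L1Module.
Variables (X : completeNormedModType R[i]) (la : A -> X -> X) (ra : X -> A -> X).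
Hypothesis bX : is_banach_bimodule mul la ra.

Lemma l1_la_ex a (y : l1 X) :
  exists2 z : l1 X, l1_fun z = (fun k => la a (l1_fun y k)) & nm z <= nm a * nm y.
Proof. by apply: l1_map_ex; [exact: nm_ge0|exact: (la_nm bX)]. Qed.

Lemma l1_ra_ex a (y : l1 X) :
  exists2 z : l1 X, l1_fun z = (fun k => ra (l1_fun y k) a) & nm z <= nm a * nm y.
Proof.
apply: (@l1_map_ex _ _ (fun x => ra x a)); first exact: nm_ge0.
by move=> x; rewrite mulrC (ra_nm bX).
Qed.

Definition l1_la a y : l1 X := sval (cid2 (l1_la_ex a y)).
Definition l1_ra y a : l1 X := sval (cid2 (l1_ra_ex a y)).

Lemma l1_laE a y k : l1_fun (l1_la a y) k = la a (l1_fun y k).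
Proof. by rewrite /l1_la; case: cid2 => z /= ->. Qed.

Lemma l1_raE a y k : l1_fun (l1_ra y a) k = ra (l1_fun y k) a.
Proof. by rewrite /l1_ra; case: cid2 => z /= ->. Qed.

Lemma l1_bimodule : is_banach_bimodule mul l1_la l1_ra.
Proof.
do ![split].
- by move=> a b x; apply: l1_fun_inj => n; rewrite !l1_laE (laA bX).
- by move=> a b x; apply: l1_fun_inj => n; rewrite !l1_raE (raA bX).
- by move=> a b x; apply: l1_fun_inj => n; rewrite !(l1_raE, l1_laE) (lraA bX).
- by move=> a k x y; apply: l1_fun_inj => n; rewrite !(l1_laE, l1_funP) (laP bX).
- by move=> x k a b; apply: l1_fun_inj => n; rewrite !(l1_laE, l1_funP) (laPl bX).
- by move=> a k x y; apply: l1_fun_inj => n; rewrite !(l1_raE, l1_funP) (raP bX).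
- by move=> x k a b; apply: l1_fun_inj => n; rewrite !(l1_raE, l1_funP) (raPr bX).
- move=> a x; rewrite !normE -rmorphM lecR /l1_la; by case: cid2.
- move=> a x; rewrite !normE -rmorphM lecR mulrC /l1_ra; by case: cid2.
Qed.

Lemma l1_inj_la n a x : l1_la a (l1_inj n x) = l1_inj n (la a x).
Proof.
apply: l1_fun_inj => k; rewrite l1_laE !l1_injE; case: ifP => // _.
(* The value at 0 is extracted from linearity by writing 0 as [-1 *: 0 + 0]. *)
by rewrite -[0 in LHS](addNr 0) -scaleN1r (laP bX) scaleN1r addNr.
Qed.

Lemma l1_inj_ra n a x : l1_ra (l1_inj n x) a = l1_inj n (ra x a).
Proof.
apply: l1_fun_inj => k; rewrite l1_raE !l1_injE; case: ifP => // _.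
by rewrite -[0 in LHS](addNr 0) -scaleN1r (raP bX) scaleN1r addNr.
Qed.

Lemma l1_inj_lin n (k : R[i]) (x y : X) :
  l1_inj n (k *: x + y) = k *: l1_inj n x + l1_inj n y.
Proof.
apply: l1_fun_inj => m; rewrite l1_funP !l1_injE; case: ifP => // _.
by rewrite scaler0 addr0.
Qed.

Variable Ds : nat -> A -> X -> R[i].
Hypothesis bDs : forall n, bder la ra (Ds n) 1.

(** The dual of the l^1 sum is the l^infinity sum of the duals; [l1_der a] is the bounded sequence
    of functionals [Ds n a], and [bDs] makes the pairing converge absolutely. *)
Definition l1_der (a : A) (y : l1 X) : R[i] := csum (fun n => Ds n a (l1_fun y n)).

Lemma l1_der_summable a y : abs_summable (fun n => Ds n a (l1_fun y n)) (nm a * nm y).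
Proof.
move=> N; apply: le_trans (ler_wpM2l (nm_ge0 a) (l1_sum_le y N)).
rewrite mulr_sumr; apply: ler_sum => k _.
by have [_ _ _ h _] := bDs k; rewrite (le_trans (h _ _))// mul1r.
Qed.

Lemma l1_derP : bder l1_la l1_ra l1_der 1.
Proof.
split=> //.
- move=> a k x y; rewrite /l1_der.
  rewrite -(csum_lin k (l1_der_summable a x) (l1_der_summable a y)).
  by congr csum; apply/funext => n; have [h _ _ _ _] := bDs n; rewrite l1_funP h.
- move=> k a b x; rewrite /l1_der.
  rewrite -(csum_lin k (l1_der_summable a x) (l1_der_summable b x)).
  by congr csum; apply/funext => n; have [_ h _ _ _] := bDs n; rewrite h.
- by move=> a x; rewrite mul1r; exact: csum_le (l1_der_summable a x).
- move=> a b x; rewrite /l1_der -[X in X + _]mul1r.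
  rewrite -(csum_lin 1 (l1_der_summable b (l1_ra x a))
    (l1_der_summable a (l1_la b x))).
  congr csum; apply/funext => n; have [_ _ _ _ h] := bDs n.
  by rewrite h l1_raE l1_laE mul1r.
Qed.

(** This lets an approximant of the glued derivation be restricted to one of each [Ds n]. *)
Lemma l1_der_inj n a x : l1_der a (l1_inj n x) = Ds n a x.
Proof.
rewrite /l1_der -[RHS](csum_single n); congr csum; apply/funext => k.
rewrite l1_injE; case: eqP => [->//|_].
have [h _ _ _ _] := bDs k.
by rewrite -(addNr 0) -scaleN1r h mulN1r addNr.
Qed.

End L1Module.

(* Otherwise there are derivations [Ds n] of norm at most 1 such that [Ds n]
   has no approximant of norm at most [n]; the components of an approximant of
   their sum over the l^1-module contradict this. *)
Lemma uniform_semi_inner (X : completeNormedModType R[i]) (la : A -> X -> X)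
    (ra : X -> A -> X) (e : R) :
  unif_approx_semi_amenable mul -> is_banach_bimodule mul la ra -> 0 < e ->
  exists2 C : R, 0 <= C & forall D, bder la ra D 1 ->
    exists xi eta, [/\ blin xi C, blin eta C
      & forall a x, nm (xi (ra x a) - eta (la a x) - D a x) <= e * nm a * nm x].
Proof.
move=> HA bX e0; apply: contrapT => hC.
have bad (n : nat) : exists D, bder la ra D 1 /\ ~ exists xi eta,
    [/\ blin xi n%:R, blin eta n%:R
      & forall a x, nm (xi (ra x a) - eta (la a x) - D a x) <= e * nm a * nm x].
  apply: contrapT => h; apply: hC; exists n%:R; first exact: ler0n.
  by move=> D bD; apply: contrapT => hD; apply: h; exists D.
have [Ds hDs] := choice bad.
have bDs n : bder la ra (Ds n) 1 by case: (hDs n).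
have /is_cont_derivationP cD : exists r, bder (l1_la bX) (l1_ra bX) (l1_der Ds) r.
  by exists 1; exact: l1_derP.
have [xi [eta [xid [etad conv]]]] := HA _ _ _ (l1_bimodule bX) _ cD.
(* A single pair from the sequence, with error [e] on the unit balls, is enough. *)
have [|N /(_ N (leqnn _)) HN] := conv e%:C; first by rewrite ltcR.
have /is_dual_eltP[C1 b1] := xid N; have /is_dual_eltP[C2 b2] := etad N.
have [l1xi C10 n1xi] := b1; have [l2 C20 n2] := b2.
(* This [n] exceeds the bounds of both functionals, so their [n]-th components are approximants of
   [Ds n] of norm at most [n], against the choice of [Ds n]. *)
pose n := (Num.truncn (C1 + C2)).+1.
have Cn : C1 + C2 <= n%:R by rewrite ltW// truncnS_gt.
have [_ []] := hDs n.
have comp (f : l1 X -> R[i]) C : blin f C -> C <= n%:R ->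
    blin (fun x : X => f (l1_inj n x)) n%:R.
  move=> [fl C0 fC] Cn'; split=> // [k x y|x]; first by rewrite l1_inj_lin fl.
  rewrite (le_trans (fC _))//; apply: ler_pM => //; rewrite ?nm_ge0//.
  exact: l1_inj_nm.
exists (fun x => xi N (l1_inj n x)), (fun x => eta N (l1_inj n x)).
have B1 : blin (fun x => xi N (l1_inj n x)) n%:R by apply: comp b1 _; lra.
have B2 : blin (fun x => eta N (l1_inj n x)) n%:R by apply: comp b2 _; lra.
split=> //.
have [Dr Dl _ _ _] := bDs n.
have [xil _ _] := B1; have [etal _ _] := B2.
pose F a x := xi N (l1_inj n (ra x a)) - eta N (l1_inj n (la a x)) - Ds n a x.
have Fr a k x y : F a (k *: x + y) = k * F a x + F a y.
  by rewrite /F (raP bX) (laP bX) xil etal Dr; ring.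
have Fl k a b x : F (k *: a + b) x = k * F a x + F b x.
  by rewrite /F (raPr bX) (laPl bX) xil etal Dl; ring.
(* Applied to [F 0 x] and [F a 0], this extracts homogeneity from the combined linearity
   identities. *)
have z0 (z : R[i]) : z = 1 * z + z -> z = 0.
  by rewrite mul1r => /(congr1 (fun w => w - z)); rewrite subrr addrK => <-.
apply: (@bilinear_ball_bound _ A X F e).
- move=> k a x; rewrite -[k *: a]addr0 Fl (z0 (F 0 x)) ?addr0//.
  by rewrite -Fl scale1r addr0.
- move=> k a x; rewrite -[k *: x]addr0 Fr (z0 (F a 0)) ?addr0//.
  by rewrite -Fr scale1r addr0.
move=> a x a1 x1; rewrite /F -(l1_der_inj bDs) -(l1_inj_ra bX) -(l1_inj_la bX).
rewrite -lecR -normE; apply: HN; rewrite normE lecR//.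
exact: le_trans (l1_inj_nm _ _) x1.
Qed.

(** * From approximation by inner derivations to innerness *)

Section Iteration.
Variables (X : completeNormedModType R[i]) (la : A -> X -> X) (ra : X -> A -> X).
Hypothesis bX : is_banach_bimodule mul la ra.
Variable C : R.
Hypothesis C0 : 0 <= C.
Hypothesis half : forall D, bder la ra D 1 ->
  exists2 f, blin f C &
    forall a x, nm (D a x - ad la ra f a x) <= 2^-1 * nm a * nm x.

(** Applying [half] to [D] divided by [r] gives one step of the iteration: the remainder is again a
    derivation, with half the bound. *)
Lemma half_scaled D r : 0 < r -> bder la ra D r ->
  exists2 f, blin f (C * r) & bder la ra (fun a x => D a x - ad la ra f a x) (r / 2).
Proof.
move=> r0 bD; have r0' := ltW r0; have rn0 : r != 0 by rewrite gt_eqF.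
have rc0 : r%:C != 0 :> R[i] by rewrite gt_eqF// ltcR.
have := bder_scale (s := r^-1) _ bD; rewrite invr_ge0 mulVf// => /(_ r0')/half[f].
move=> [fl _ fC] fh.
have bf : blin (fun x => r%:C * f x) (C * r).
  split=> [k x y||x]; [by rewrite fl; ring|exact: mulr_ge0|].
  by rewrite nmM nmR// mulrC mulrAC ler_wpM2r.
exists (fun x => r%:C * f x) => //.
apply: (bder_sub_ad bX bD bf); first by rewrite divr_ge0.
move=> a x; rewrite (_ : _ - _ = r%:C * (r^-1%:C * D a x - ad la ra f a x)).
  by rewrite nmM nmR// -!mulrA ler_wpM2l// !mulrA.
by rewrite /ad fmorphV/=; field.
Qed.

(* Geometric series: the error of the n-th approximation is [r / 2 ^ n]. *)
Lemma inner_of_half D r : bder la ra D r ->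
  exists2 f, is_dual_elt f & forall a x, D a x = ad la ra f a x.
Proof.
(* The bound may be enlarged to [r + 1], since the scaling step divides by it. *)
wlog r0 : r / 0 < r.
  move=> h bD; have [_ _ r0 _ _] := bD.
  by apply: (h (r + 1)); [lra|apply: bderW bD _; lra].
move=> bD.
(* The choice of a functional is made total: pairs that are not a derivation with a positive bound
   get the zero functional. *)
have /choice[sel selP] (Er : (A -> X -> R[i]) * R) : exists f,
    0 < Er.2 -> bder la ra Er.1 Er.2 ->
    blin f (C * Er.2) /\ bder la ra (fun a x => Er.1 a x - ad la ra f a x) (Er.2 / 2).
  case: Er => E s; have [[s0 bE]|h] := pselect (0 < s /\ bder la ra E s).
    by have [f] := half_scaled s0 bE; exists f.
  by exists (fun=> 0) => s0 bE; case: h.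
pose step (E : A -> X -> R[i]) s := fun a x => E a x - ad la ra (sel (E, s)) a x.
pose rn n := r / 2 ^+ n.
(* [E n] is the remainder after [n] corrections, with bound [rn n]; the functional [g n] gives the
   next correction. *)
pose E := fix E n := if n is m.+1 then step (E m) (rn m) else D.
pose g n := sel (E n, rn n).
have rn0 n : 0 < rn n by rewrite divr_gt0// exprn_gt0.
have bE n : bder la ra (E n) (rn n).
  elim: n => [|n ih]; first by rewrite /rn expr0 divr1.
  have [_] := selP (E n, rn n) (rn0 n) ih.
  by rewrite /= /rn exprSr invfM mulrA.
have bg n : blin (g n) (C * rn n) by have [] := selP (E n, rn n) (rn0 n) (bE n).
have rsum N : \sum_(0 <= k < N) rn k = 2 * r - 2 * rn N.
  elim: N => [|N ih]; first by rewrite big_nil /rn expr0 divr1 subrr.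
  rewrite big_nat_recr//= ih /rn exprS invfM.
  by field; rewrite expf_neq0.
(* The bounds [C * rn n] form a geometric series with sum [C * (2 * r)]. *)
have gs x : abs_summable (fun n => g n x) (C * (2 * r) * nm x).
  move=> N; apply: (@le_trans _ _ (\sum_(0 <= k < N) C * rn k * nm x)).
    by apply: ler_sum => k _; have [] := bg k.
  rewrite -mulr_suml ler_wpM2r ?nm_ge0// -mulr_sumr ler_wpM2l// rsum.
  by have := rn0 N; lra.
pose f x := csum (fun n => g n x).
have bf : blin f (C * (2 * r)).
  split=> [k x y||x]; last exact: csum_le.
  - rewrite /f -(csum_lin k (gs x) (gs y)); congr csum; apply/funext => n.
    by have [h _ _] := bg n; rewrite h.
  - by rewrite !mulr_ge0// ltW.
exists f; first by apply/is_dual_eltP; exists (C * (2 * r)).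
move=> a x.
(* The corrections telescope; it remains to see that [E N a x] tends to 0. *)
have EN N : \sum_(0 <= k < N) g k (ra x a) + -1 * \sum_(0 <= k < N) g k (la a x)
    = D a x - E N a x.
  elim: N => [|N ih]; first by rewrite !big_nil subrr mulr0 addr0.
  rewrite !big_nat_recr//= /step -/(g N) /ad.
  rewrite mulrDr addrACA ih; ring.
have := tendsD (csumP (gs (ra x a)))
  (@tendsZ _ R[i]^o (-1) _ _ (csumP (gs (la a x)))).
rewrite scaleN1r -/(f _) -/(f _) => /tends_unique lim; apply/esym/lim => {lim}.
move=> e e0.
pose M := r * nm a * nm x.
have M0 : 0 <= M by rewrite !mulr_ge0 ?nm_ge0// ltW.
(* From here on M / e < n + 1 <= 2 ^ n, so the remainder M / 2 ^ n is at most [e]. *)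
exists (Num.truncn (M / e)) => n nN; rewrite EN addrAC subrr add0r nmN.
have [_ _ _ h _] := bE n; rewrite (le_trans (h a x))//.
rewrite (_ : _ * _ = M / 2 ^+ n); last by rewrite /M /rn; ring.
rewrite ler_pdivrMr ?exprn_gt0// mulrC -ler_pdivrMr//.
rewrite ltW// (lt_le_trans (truncnS_gt _))//.
rewrite -natrX ler_nat (leq_trans (n := n.+1))// ltn_expl//.
Qed.

End Iteration.

(** * A right identity of the bidual, and the passage to a single functional *)

Section VirtualIdentity.
Hypothesis bA : is_banach_algebra mul.

Lemma mul_nm a b : nm (mul a b) <= nm a * nm b.
Proof. by have [_ _ _ h] := bA; rewrite -lecR rmorphM/= -!normE. Qed.

Lemma dual_ra_ex (f : dual A) (a : A) :
  exists2 g : dual A, dual_fun g = (fun b => dual_fun f (mul a b))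
    & nm g <= nm f * nm a.
Proof.
have [fl f0 fC] := dual_blin f; have [_ ml _ _] := bA.
apply: dual_ex; split=> [k x y||x]; first by rewrite ml fl.
  by rewrite mulr_ge0 ?nm_ge0.
by rewrite (le_trans (fC _))// -mulrA ler_wpM2l// mul_nm.
Qed.

Definition dual_ra f a : dual A := sval (cid2 (dual_ra_ex f a)).
Definition dual_la (a : A) (f : dual A) : dual A := 0.

Lemma dual_raE f a b : dual_fun (dual_ra f a) b = dual_fun f (mul a b).
Proof. by rewrite /dual_ra; case: cid2 => g /= ->. Qed.

Lemma dual_bimodule : is_banach_bimodule mul dual_la dual_ra.
Proof.
have [mA _ ml _] := bA.
have ra0 a : dual_ra 0 a = 0 by apply: dual_fun_inj => b; rewrite dual_raE.
do ![split] => //.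
- by move=> a b f; apply: dual_fun_inj => c; rewrite !dual_raE mA.
- by move=> a k x y; rewrite /dual_la scaler0 addr0.
- by move=> a k x y; rewrite /dual_la scaler0 addr0.
- by move=> a k f g; apply: dual_fun_inj => b; rewrite !(dual_raE, dual_funP).
- move=> f k a b; apply: dual_fun_inj => c; rewrite !(dual_raE, dual_funP) ml.
  by have [fl _ _] := dual_blin f; rewrite fl.
- by move=> a f; rewrite /dual_la normr0 mulr_ge0.
- by move=> a f; rewrite !normE -rmorphM lecR /dual_ra; case: cid2.
Qed.

(* For the trivial left action on A^*, the embedding of A in its bidual is a
   derivation; that it is inner says that [E] is a right identity of A^**. *)
Lemma virtual_right_identity : unif_approx_semi_amenable mul ->
  exists E : dual A -> R[i], exists2 M, blin E M &
    forall f a, E (dual_ra f a) = dual_fun f a.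
Proof.
move=> HA; have bD : bder dual_la dual_ra (fun a f => dual_fun f a) 1.
  split=> //.
  - by move=> k a b f; have [fl _ _] := dual_blin f; rewrite fl.
  - by move=> a f; have [_ _ h] := dual_blin f; rewrite mul1r mulrC.
  - by move=> a b f; rewrite dual_raE addr0.
have [||C C0 h] := @uniform_semi_inner _ dual_la dual_ra 2^-1 HA.
- exact: dual_bimodule.
- by rewrite invr_gt0.
have [|E /is_dual_eltP[M EM] EP] := inner_of_half dual_bimodule C0 _ bD.
  move=> D /h[xi [eta [bxi beta hxi]]]; exists xi => // a x.
  (* The left action is zero, so the terms with [la] vanish both here and in [ad], and [xi] alone is
     an approximant. *)
  rewrite nm_distC; have := hxi a x.
  by rewrite /ad (blin0 bxi) (blin0 beta).
exists E, M => // f a; have := EP a f.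
by rewrite /ad (blin0 EM) subr0.
Qed.

(** This supplies the hypothesis of the iteration: the pair (xi, eta) is traded for one functional,
    at the price of a factor 1 + 3 M in the error. *)
Lemma half_inner (X : completeNormedModType R[i]) (la : A -> X -> X)
    (ra : X -> A -> X) :
  unif_approx_semi_amenable mul -> is_banach_bimodule mul la ra ->
  exists2 C, 0 <= C & forall D, bder la ra D 1 ->
    exists2 f, blin f C &
      forall a x, nm (D a x - ad la ra f a x) <= 2^-1 * nm a * nm x.
Proof.
move=> HA bX; have [E [M bE EP]] := virtual_right_identity HA.
have [El M0 EM] := bE.
(* Chosen so that the final error e + 3 M e equals 1/2. *)
pose e : R := (2 * (1 + 3 * M))^-1.
have e0 : 0 < e by rewrite invr_gt0; lra.
have [C C0 h] := uniform_semi_inner HA bX e0.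
(* [C] bounds [eta]; the correction by [E] is bounded by [M] times the bound [2 * C] of eta - xi. *)
exists (C + M * (2 * C)); first by rewrite addr_ge0// !mulr_ge0.
move=> D bD; have [xi [eta [bxi beta hT]]] := h D bD.
have [xil _ xiC] := bxi; have [etal _ etaC] := beta; have [_ _ _ _ DM] := bD.
pose zeta x := eta x - xi x.
have bz : blin zeta (2 * C).
  split=> [k x y||x]; [by rewrite /zeta xil etal; ring|by rewrite mulr_ge0|].
  have := nmB (eta x) (xi x); have := xiC x; have := etaC x.
  by rewrite -/(zeta x); lra.
have [zl _ zC] := bz.
(* [zeta] measures the failure of a |-> a.xi - eta.a to be a derivation. *)
have zsmall a b x : nm (zeta (ra (la b x) a)) <= 3 * e * nm b * nm x * nm a.
  pose F a x := xi (ra x a) - eta (la a x) - D a x.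
  have -> : zeta (ra (la b x) a) = F (mul a b) x - F b (ra x a) - F a (la b x).
    by rewrite /F /zeta DM -(raA bX) -(laA bX) (lraA bX); ring.
  have := hT (mul a b) x; have := hT b (ra x a); have := hT a (la b x).
  rewrite -/(F _ _) -/(F _ _) -/(F _ _) => h1 h2 h3.
  have := nmB (F (mul a b) x - F b (ra x a)) (F a (la b x)).
  have := nmB (F (mul a b) x) (F b (ra x a)).
  have := ler_wpM2l (mulr_ge0 (ltW e0) (nm_ge0 a)) (la_nm bX b x).
  have := ler_wpM2l (mulr_ge0 (ltW e0) (nm_ge0 b)) (ra_nm bX x a).
  have := ler_wpM2r (nm_ge0 x) (ler_wpM2l (ltW e0) (mul_nm a b)).
  move: h1 h2 h3; lra.
(* This crude bound makes x |-> E(phi x) continuous; the small bound of [bphi'], available only at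
   points b x, controls the final error. *)
have bphi x : blin (fun a => zeta (ra x a)) (2 * C * nm x).
  split=> [k a b||a]; first by rewrite (raPr bX) zl.
    by rewrite !mulr_ge0 ?nm_ge0.
  by rewrite (le_trans (zC _))// -[leRHS]mulrA ler_wpM2l ?mulr_ge0// (ra_nm bX).
have bphi' b x : blin (fun a => zeta (ra (la b x) a)) (3 * e * nm b * nm x).
  have [hl _ _] := bphi (la b x); split=> //.
  by rewrite !mulr_ge0 ?nm_ge0// ltW.
have phi_ex x : {phi : dual A | dual_fun phi = fun a => zeta (ra x a)}.
  by apply: cid; have [g] := dual_ex (bphi x); exists g.
pose phi x := sval (phi_ex x).
have phiE x a : dual_fun (phi x) a = zeta (ra x a).
  by rewrite /phi (svalP (phi_ex x)).
have phi_nm x B : blin (fun a => zeta (ra x a)) B -> nm (phi x) <= B.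
  move=> /dual_ex[g gE gB]; rewrite (_ : phi x = g)//.
  by apply: dual_fun_inj => a; rewrite phiE gE.
have fM x B : blin (fun a => zeta (ra x a)) B -> nm (E (phi x)) <= M * B.
  by move=> /phi_nm xB; rewrite (le_trans (EM _))// ler_wpM2l.
(* Associativity gives phi(x a) = phi(x).a, and the identity property of [E] then evaluates phi(x)
   at [a]. *)
have fra x a : E (phi (ra x a)) = zeta (ra x a).
  rewrite -phiE -EP; congr E; apply: dual_fun_inj => b.
  by rewrite dual_raE !phiE (raA bX).
exists (fun x => eta x - E (phi x)).
  split=> [k x y||x]; last first.
  - have := fM _ _ (bphi x); have := etaC x; have := nmB (eta x) (E (phi x)); lra.
  - by rewrite addr_ge0// !mulr_ge0.
  rewrite (_ : phi (k *: x + y) = k *: phi x + phi y).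
    by rewrite etal El; ring.
  by apply: dual_fun_inj => a; rewrite dual_funP !phiE (raP bX) zl.
move=> a x; rewrite /ad fra.
(* As eta - zeta = xi, the original approximation reappears, and E(phi(a x)) is the only new error
   term. *)
have -> : D a x - (eta (ra x a) - zeta (ra x a) - (eta (la a x) - E (phi (la a x))))
    = - (xi (ra x a) - eta (la a x) - D a x) - E (phi (la a x)).
  by rewrite /zeta; ring.
have := nmB (- (xi (ra x a) - eta (la a x) - D a x)) (E (phi (la a x))).
rewrite nmN => /le_trans; apply.
have -> : 2^-1 * nm a * nm x = e * nm a * nm x + M * (3 * e * nm a * nm x).
  by rewrite /e; field; lra.
by apply: lerD; [exact: hT|exact: fM (bphi' a x)].
Qed.

End VirtualIdentity.
End Derivations.

Theorem theorem6p2 (R : realType) (A : completeNormedModType R[i])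
  (mul : A -> A -> A) :
  is_banach_algebra mul ->
  unif_approx_semi_amenable mul ->
  amenable mul.
Proof.
move=> bA HA X la ra bX D /is_cont_derivationP[r bD].
have [C C0 half] := half_inner bA HA bX.
have [f fd fD] := inner_of_half bX C0 half bD.
by exists f.
Qed.
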